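(* Let $a<b$ be real numbers with $[a,b]\subset\mathbb{R}\setminus\{0\}$. Let $f,g:[a,b]\to\mathbb{R}$, with $f$ integrable on $[a,b]$, and assume that either ($g$ is harmonic convex and $f$ is symmetrized harmonic convex on $[a,b]$) or ($g$ is harmonic concave and $f$ is symmetrized harmonic concave on $[a,b]$). Let $\breve f$ denote the symmetrical transform of $f$ on $[a,b]$. Then $$\frac{f(a)+f(b)}{2}\cdot\frac{ab}{b-a}\int_a^b\frac{g(t)}{t^2}\,dt+\frac{g(a)+g(b)}{2}\cdot\frac{ab}{b-a}\int_a^b\frac{f(t)}{t^2}\,dt-\frac{f(a)+f(b)}{2}\cdot\frac{g(a)+g(b)}{2}\le\frac{ab}{b-a}\int_a^b\frac{\breve f(t)g(t)}{t^2}\,dt$$ and $$\frac{ab}{b-a}\int_a^b\frac{\breve f(t)g(t)}{t^2}\,dt\le\frac{g(a)+g(b)}{2}\cdot\frac{ab}{b-a}\int_a^b\frac{f(t)}{t^2}\,dt+f\left(\frac{2ab}{a+b}\right)\frac{ab}{b-a}\int_a^b\frac{g(t)}{t^2}\,dt-f\left(\frac{2ab}{a+b}\right)\frac{g(a)+g(b)}{2}.$$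
   Context: For an interval $I\subset\mathbb{R}\setminus\{0\}$, a function $g:I\to\mathbb{R}$ is harmonic convex on $I$ if for all $x,y\in I$ and all $\alpha,\beta\ge 0$ with $\alpha+\beta=1$, $g\left(\frac{xy}{\alpha x+\beta y}\right)\le \alpha g(y)+\beta g(x)$; it is harmonic concave if the reverse inequality always holds. For $f:[a,b]\to\mathbb{R}$ with $[a,b]\subset\mathbb{R}\setminus\{0\}$, the symmetrical transform of $f$ on $[a,b]$ is $\breve f(t)=\frac12\left[f(t)+f\left(\frac{abt}{(a+b)t-ab}\right)\right]$, $t\in[a,b]$. The function $f$ is symmetrized harmonic convex (concave) on $[a,b]$ if $\breve f$ is harmonic convex (concave) on $[a,b]$. *)

(* Defs.v *)
(* MathComp-Analysis; the reals are an arbitrary [R : realType]. *)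
From mathcomp Require Import all_boot all_order all_algebra.
From mathcomp Require Import all_classical all_reals all_analysis.

Set Implicit Arguments.
Unset Strict Implicit.
Unset Printing Implicit Defensive.

Import Order.TTheory GRing.Theory Num.Theory.
Import numFieldNormedType.Exports.

Local Open Scope ring_scope.

(* A function on an interval is a total function R -> R of which only the
   values on that interval are constrained. The definitions below are meant for
   intervals that do not contain 0. *)

Definition harmonic_convex (R : realType) (I : interval R) (g : R -> R) : Prop :=
  forall x y, x \in I -> y \in I ->
  forall alpha beta : R, 0 <= alpha -> 0 <= beta -> alpha + beta = 1 ->
    g (x * y / (alpha * x + beta * y)) <= alpha * g y + beta * g x.

Definition harmonic_concave (R : realType) (I : interval R) (g : R -> R) : Prop :=
  forall x y, x \in I -> y \in I ->
  forall alpha beta : R, 0 <= alpha -> 0 <= beta -> alpha + beta = 1 ->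
    alpha * g y + beta * g x <= g (x * y / (alpha * x + beta * y)).

Definition symmetrical_transform (R : realType) (a b : R) (f : R -> R) : R -> R :=
  fun t => 2^-1 * (f t + f (a * b * t / ((a + b) * t - a * b))).

Definition symmetrized_harmonic_convex (R : realType) (a b : R) (f : R -> R) :
    Prop :=
  harmonic_convex `[a, b] (symmetrical_transform a b f).

Definition symmetrized_harmonic_concave (R : realType) (a b : R) (f : R -> R) :
    Prop :=
  harmonic_concave `[a, b] (symmetrical_transform a b f).

(* [lebesgue_measure] lives on the Borel sets, so integrability against it would
   require Borel measurability; its completion gives Lebesgue integrability in
   the usual sense, and in particular covers every Riemann integrable function. *)
Notation lebm := completed_lebesgue_measure.

(* Main.v *)
From HB Require Import structures.
Require Import Defs.
From mathcomp Require Import all_boot all_order all_algebra.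
From mathcomp Require Import all_classical all_reals all_analysis.
From mathcomp Require Import measurable_realfun ring lra.

Import Order.TTheory GRing.Theory Num.Theory.
Import numFieldNormedType.Exports.

Local Open Scope classical_set_scope.
Local Open Scope ring_scope.

(** The substitution u = 1/t turns harmonic convexity into convexity, the measure
dt/t^2 into the Lebesgue measure, and the map sigma(t) = abt/((a+b)t - ab) into
the reflection u |-> 1/a + 1/b - u, since 1/sigma(t) = 1/a + 1/b - 1/t. Write
hs = (h + h o sigma)/2 for the symmetrical transform, F = (f(a) + f(b))/2,
G = (g(a) + g(b))/2, and m for the value of f at the harmonic mean 2ab/(a+b),
the fixed point of sigma.

In the convex case, pointwise on [a, b],
  gs <= G ([harmonic_convex_sum])   and   m <= fs <= F,
the last two because fs is itself harmonic convex and sigma-invariant, takes the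
value F at both endpoints and the value m at the harmonic mean. Hence
  (F - fs)(G - gs) >= 0   and   (m - fs)(G - gs) <= 0,
and both signs persist in the concave case, where each of the three bounds is
reversed ([product_gap_signs]). Integrating against nu = dt/t^2 gives the two
inequalities. Indeed nu has total mass 1/a - 1/b = (b-a)/(ab), and as nu is
sigma-invariant, hs and h have the same integral; applied to g, to f and to
fs * g, whose symmetrization is fs * gs, this evaluates the integral of
(H - fs)(G - gs) for every constant H ([Rintegral_product_gap]).

What is left is regularity. A harmonic convex function satisfies
h(z) <= max(h(x), h(y)) for z between x and y, so its sublevel sets are
intervals and it is Borel measurable ([quasiconvex_measurable]); the same lemma
applies to the monotone functions 1/t^2 and sigma. It is also bounded
([harmonic_convex_bounded]). The function f is only Lebesgue integrable, so the
invariance of nu has to hold on all Lebesgue measurable sets: it is computed on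
the rays [c, +oo[ with the fundamental theorem of calculus, extended to Borel
sets by the pi-lambda theorem, and then to the completion by squeezing a
measurable set between two Borel sets of the same measure
([inv_sq_measure_reflection]). *)

Set Implicit Arguments.
Unset Strict Implicit.

(** * Quasiconvexity and measurability *)

(** The sublevel sets are intervals, hence Borel sets. Convex and monotone functions
are both instances. *)
Lemma quasiconvex_measurable (R : realType) (D : set R) (f : R -> R) :
  is_interval D ->
  (forall x y z, D x -> D y -> x <= z <= y -> f z <= Num.max (f x) (f y)) ->
  measurable_fun D f.
Proof.
move=> iD qf mD.
apply: (measurability _ (RGenInftyO.measurableE R) _ mD).
move=> _ [_ [c ->] <-]; apply: is_interval_measurable.
move=> x y [Dx fx] [Dy fy] z xzy; split; first exact: iD xzy.
move: fx fy; rewrite /= !in_itv/= => fx fy.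
by rewrite (le_lt_trans (qf _ _ _ Dx Dy xzy))// gt_max fx.
Qed.

(** * The harmonic reflection of an interval *)

(** The decreasing involution of [a, b] that exchanges a and b and fixes their
harmonic mean. *)
Definition harmonic_reflection {R : realType} (a b t : R) : R :=
  a * b * t / ((a + b) * t - a * b).

Definition harmonic_mean {R : realType} (a b : R) : R := 2 * a * b / (a + b).

(** The identity outside of [a, b], so that the map is defined, measurable and
measure preserving on the whole line. *)
Definition reflection {R : realType} (a b t : R) : R :=
  if t \in `[a, b] then harmonic_reflection a b t else t.

Section harmonic_reflection.
Context {R : realType} (a b : R).
Hypotheses (ltab : a < b) (ab0 : 0 \notin (`[a, b]%R : interval R)).
Local Notation D := (`[a, b]%classic : set R).
Local Notation sigma := (harmonic_reflection a b).

Lemma a_in : a \in `[a, b]. Proof. by rewrite in_itv/= lexx ltW. Qed.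

Lemma b_in : b \in `[a, b]. Proof. by rewrite in_itv/= lexx andbT ltW. Qed.

Lemma sub_itv x y z : x \in `[a, b] -> y \in `[a, b] -> x <= z <= y ->
  z \in `[a, b].
Proof.
rewrite !in_itv/= => /andP[ax _] /andP[_ yb] /andP[xz zy].
by rewrite (le_trans ax xz) (le_trans zy yb).
Qed.

Lemma itv_neq0 t : t \in `[a, b] -> t != 0.
Proof. by move=> tD; apply: contraNneq ab0 => <-. Qed.

Lemma itv_mul_gt0 x y : x \in `[a, b] -> y \in `[a, b] -> 0 < x * y.
Proof.
move: ab0; rewrite !in_itv/= negb_and -!ltNge.
by move=> /orP[] h /andP[h1 h2] /andP[h3 h4]; nra.
Qed.

Lemma reflection_den_gt0 t : t \in `[a, b] -> 0 < (a + b) * t - a * b.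
Proof.
move: ab0; rewrite !in_itv/= negb_and -!ltNge.
by move=> /orP[] h /andP[h1 h2]; nra.
Qed.

Lemma harmonic_reflectionB x y : x \in `[a, b] -> y \in `[a, b] ->
  sigma x - sigma y = (a * b) ^+ 2 * (y - x) /
    (((a + b) * x - a * b) * ((a + b) * y - a * b)).
Proof.
move=> /reflection_den_gt0/lt0r_neq0 hx /reflection_den_gt0/lt0r_neq0 hy.
by rewrite /harmonic_reflection; field; rewrite hx hy.
Qed.

Lemma harmonic_reflection_le x y : x \in `[a, b] -> y \in `[a, b] ->
  (sigma x <= sigma y) = (y <= x).
Proof.
move=> hx hy; rewrite -subr_ge0 harmonic_reflectionB// -[RHS]subr_ge0.
rewrite pmulr_lge0 ?invr_gt0 ?mulr_gt0 ?reflection_den_gt0//.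
by rewrite pmulr_rge0 ?exprn_gt0// itv_mul_gt0 ?a_in ?b_in.
Qed.

Lemma harmonic_reflectiona : sigma a = b.
Proof.
have /lt0r_neq0 h := reflection_den_gt0 a_in.
by rewrite /harmonic_reflection; field.
Qed.

Lemma harmonic_reflectionb : sigma b = a.
Proof.
have /lt0r_neq0 h := reflection_den_gt0 b_in.
by rewrite /harmonic_reflection; field.
Qed.

Lemma harmonic_reflection_in t : t \in `[a, b] -> sigma t \in `[a, b].
Proof.
move=> ht; have := ht; rewrite !in_itv/= => /andP[].
rewrite -(harmonic_reflection_le ht a_in) harmonic_reflectiona => ->.
by rewrite -(harmonic_reflection_le b_in ht) harmonic_reflectionb => ->.
Qed.

Lemma harmonic_reflectionV t : t \in `[a, b] ->
  (sigma t)^-1 = a^-1 + b^-1 - t^-1.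
Proof.
move=> ht; have /lt0r_neq0 hd := reflection_den_gt0 ht.
rewrite /harmonic_reflection; field.
by rewrite (itv_neq0 a_in) (itv_neq0 b_in) (itv_neq0 ht).
Qed.

Lemma harmonic_reflectionK t : t \in `[a, b] -> sigma (sigma t) = t.
Proof.
move=> ht; apply: invr_inj.
by rewrite !harmonic_reflectionV ?harmonic_reflection_in//; ring.
Qed.

Lemma reflectionK t : t \in `[a, b] ->
  reflection a b (reflection a b t) = t.
Proof.
move=> tD; rewrite /reflection tD harmonic_reflection_in//.
exact: harmonic_reflectionK.
Qed.

Lemma preimage_reflection : reflection a b @^-1` D = D.
Proof.
apply/seteqP; split => t /=; rewrite /reflection; case: ifPn => // tD.
  by rewrite (negbTE tD).
by rewrite harmonic_reflection_in.
Qed.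

Lemma addr_endpoints_neq0 : a + b != 0.
Proof.
move: ab0 ltab; rewrite in_itv/= negb_and -!ltNge => /orP[h|h] ?.
  by rewrite gt_eqF//; lra.
by rewrite lt_eqF//; lra.
Qed.

Lemma harmonic_mean_in : harmonic_mean a b \in `[a, b].
Proof.
have lab := ltab.
rewrite in_itv/=; move: ab0; rewrite in_itv/= negb_and -!ltNge => /orP[h|h].
  have h' : 0 < a + b by lra.
  by rewrite /harmonic_mean ler_pdivlMr// ler_pdivrMr//; nra.
have h' : a + b < 0 by lra.
by rewrite /harmonic_mean ler_ndivlMr// ler_ndivrMr//; nra.
Qed.

Lemma harmonic_reflection_mean : sigma (harmonic_mean a b) = harmonic_mean a b.
Proof.
apply: invr_inj; rewrite harmonic_reflectionV ?harmonic_mean_in//.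
rewrite /harmonic_mean; field.
by rewrite (itv_neq0 a_in) (itv_neq0 b_in) addr_endpoints_neq0.
Qed.

(** The weights are the barycentric coordinates of 1/z with respect to 1/x and
1/y. *)
Lemma harmonic_between x y z : x \in `[a, b] -> y \in `[a, b] -> x <= z <= y ->
  exists al be : R, [/\ 0 <= al, 0 <= be, al + be = 1 &
    z = x * y / (al * x + be * y)].
Proof.
move=> hx hy xzy; have hz := sub_itv hx hy xzy; move: xzy => /andP[xz zy].
have [x0 y0 z0] := And3 (itv_neq0 hx) (itv_neq0 hy) (itv_neq0 hz).
have [xy|xy] := eqVneq x y.
  exists 1, 0; split=> //; first by rewrite addr0.
  have -> : z = x by apply/eqP; rewrite eq_le xz xy zy.
  by rewrite -xy mul0r addr0 mul1r mulfK.
have {xy} xy : 0 < y - x by rewrite subr_gt0 lt_neqAle xy (le_trans xz).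
have divz t : t \in `[a, b] -> 0 <= t / z.
  move=> tD; rewrite (_ : t / z = t * z / z ^+ 2); last by field.
  by rewrite divr_ge0 ?sqr_ge0// ltW// itv_mul_gt0.
have yx0 := lt0r_neq0 xy.
exists (y / z * (z - x) / (y - x)), (x / z * (y - z) / (y - x)); split.
- by rewrite divr_ge0 ?(ltW xy)// mulr_ge0 ?divz// subr_ge0.
- by rewrite divr_ge0 ?(ltW xy)// mulr_ge0 ?divz// subr_ge0.
- by field; rewrite yx0 z0.
- have -> : y / z * (z - x) / (y - x) * x + x / z * (y - z) / (y - x) * y
    = x * y / z by field; rewrite yx0 z0.
  by field; rewrite x0 y0 z0.
Qed.

(** * Harmonic convex functions *)

Section harmonic_convex.
Context (g : R -> R).
Hypothesis cg : harmonic_convex `[a, b] g.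

Lemma harmonic_convex_quasiconvex x y z : x \in `[a, b] -> y \in `[a, b] ->
  x <= z <= y -> g z <= Num.max (g x) (g y).
Proof.
move=> hx hy /(harmonic_between hx hy) [al [be [al0 be0 albe ->]]].
rewrite (le_trans (cg hx hy al0 be0 albe))//.
rewrite -[leRHS]mul1r -albe mulrDl.
by rewrite lerD// ler_wpM2l// le_max lexx ?orbT.
Qed.

Lemma harmonic_convex_measurable : measurable_fun D g.
Proof.
apply: quasiconvex_measurable; first exact: interval_is_interval.
by move=> x y z; exact: harmonic_convex_quasiconvex.
Qed.

(** The points t and sigma(t) are harmonic combinations of a and b with the two
weights exchanged, so the two convexity inequalities add up to g(a) + g(b). *)
Lemma harmonic_convex_sum t : t \in `[a, b] -> g t + g (sigma t) <= g a + g b.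
Proof.
move=> ht.
have /(harmonic_between a_in b_in) : a <= t <= b by rewrite in_itv in ht.
move=> [al [be [al0 be0 albe te]]].
have h1 := cg a_in b_in al0 be0 albe.
have h2 := cg b_in a_in al0 be0 albe.
have beE : be = 1 - al by rewrite -albe; ring.
have se : sigma t = b * a / (al * b + be * a).
  apply: invr_inj; rewrite harmonic_reflectionV// {1}te !invf_div beE.
  by field; rewrite (itv_neq0 a_in) (itv_neq0 b_in).
by rewrite {1}te se (le_trans (lerD h1 h2))// beE; lra.
Qed.

(** The harmonic midpoint of t and sigma(t) is the harmonic mean of a and b. *)
Lemma harmonic_convex_mean t : t \in `[a, b] ->
  2 * g (harmonic_mean a b) <= g t + g (sigma t).
Proof.
move=> ht; have hs := harmonic_reflection_in ht.
have half0 : 0 <= 2^-1 :> R by rewrite invr_ge0.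
have half1 : 2^-1 + 2^-1 = 1 :> R by lra.
have := cg ht hs half0 half0 half1.
suff -> : t * sigma t / (2^-1 * t + 2^-1 * sigma t) = harmonic_mean a b by lra.
have [a0 b0 t0] := And3 (itv_neq0 a_in) (itv_neq0 b_in) (itv_neq0 ht).
have /lt0r_neq0 hd := reflection_den_gt0 ht.
have nm := addr_endpoints_neq0.
rewrite /harmonic_reflection /harmonic_mean; field.
rewrite hd nm/= (_ : _ + _ = (a + b) * t ^+ 2); last by ring.
by rewrite mulf_neq0 ?expf_neq0.
Qed.

(** Quasiconvexity bounds g from above; from below, g(t) >= 2 g(m) - g(sigma(t))
at the harmonic mean m. *)
Lemma harmonic_convex_bounded :
  exists M, forall t, t \in `[a, b] -> `|g t| <= M.
Proof.
exists (`|g a| + `|g b| + 2 * `|g (harmonic_mean a b)|) => t ht.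
have ub s : s \in `[a, b] -> g s <= `|g a| + `|g b|.
  rewrite in_itv/= => /(harmonic_convex_quasiconvex a_in b_in)/le_trans; apply.
  rewrite ge_max; have := ler_norm (g a); have := ler_norm (g b).
  have := normr_ge0 (g a); have := normr_ge0 (g b); lra.
have h1 := ub _ ht; have h2 := ub _ (harmonic_reflection_in ht).
have h3 := harmonic_convex_mean ht.
have := ler_norm (g (harmonic_mean a b)).
have := ler_norm (- g (harmonic_mean a b)).
by rewrite normrN ler_norml => *; apply/andP; split; lra.
Qed.

End harmonic_convex.

Lemma harmonic_concaveN (h : R -> R) :
  harmonic_concave `[a, b] h -> harmonic_convex `[a, b] (\- h).
Proof.
move=> ch x y hx hy al be al0 be0 albe /=.
by have := ch x y hx hy al be al0 be0 albe; lra.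
Qed.

Lemma harmonic_regular (h : R -> R) :
  harmonic_convex `[a, b] h \/ harmonic_concave `[a, b] h ->
  measurable_fun D h /\ exists M, forall t, t \in `[a, b] -> `|h t| <= M.
Proof.
move=> [ch|/harmonic_concaveN ch].
  split; first exact: harmonic_convex_measurable ch.
  exact: harmonic_convex_bounded ch.
split.
  rewrite -(opprK h); apply/measurable_funN.
  exact: harmonic_convex_measurable ch.
have [M hM] := harmonic_convex_bounded ch.
by exists M => t /hM /=; rewrite normrN.
Qed.

(** * The symmetrical transform *)

Local Notation sym := (symmetrical_transform a b).

Lemma symmetrical_transformN (h : R -> R) : sym (\- h) = \- sym h.
Proof. by apply/funext => t; rewrite /symmetrical_transform /=; ring. Qed.

Lemma symmetrical_transform_reflection (h : R -> R) t : t \in `[a, b] ->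
  sym h (sigma t) = sym h t.
Proof.
move=> tD; rewrite /symmetrical_transform -!/(harmonic_reflection a b _).
by rewrite harmonic_reflectionK// addrC.
Qed.

Lemma symmetrical_transform_le (g : R -> R) t : harmonic_convex `[a, b] g ->
  t \in `[a, b] -> sym g t <= (g a + g b) / 2.
Proof.
move=> cg /(harmonic_convex_sum cg).
by rewrite /symmetrical_transform -/(harmonic_reflection a b t); lra.
Qed.

(** Applied to sym f, which is sigma-invariant, the bound g(t) + g(sigma(t)) <=
g(a) + g(b) reads 2 sym f(t) <= 2 sym f(a), and sym f(a) = (f(a) + f(b))/2. *)
Lemma symmetrized_convex_le (f : R -> R) t :
  symmetrized_harmonic_convex a b f -> t \in `[a, b] ->
  sym f t <= (f a + f b) / 2.
Proof.
move=> cf tD; have := harmonic_convex_sum cf tD.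
have bE : sym f b = sym f a.
  by rewrite -(symmetrical_transform_reflection _ a_in) harmonic_reflectiona.
have aE : sym f a = (f a + f b) / 2.
  rewrite /symmetrical_transform -/(harmonic_reflection a b a).
  by rewrite harmonic_reflectiona mulrC.
by rewrite symmetrical_transform_reflection// bE aE; lra.
Qed.

Lemma symmetrized_convex_ge (f : R -> R) t :
  symmetrized_harmonic_convex a b f -> t \in `[a, b] ->
  f (harmonic_mean a b) <= sym f t.
Proof.
move=> cf tD; have := harmonic_convex_mean cf tD.
have mE : sym f (harmonic_mean a b) = f (harmonic_mean a b).
  rewrite /symmetrical_transform -/(harmonic_reflection a b _).
  by rewrite harmonic_reflection_mean; lra.
by rewrite symmetrical_transform_reflection// mE; lra.
Qed.

(** Negating both f and g exchanges the two cases and leaves both products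
unchanged. *)
Lemma product_gap_signs (f g : R -> R) :
  (harmonic_convex `[a, b] g /\ symmetrized_harmonic_convex a b f) \/
  (harmonic_concave `[a, b] g /\ symmetrized_harmonic_concave a b f) ->
  forall t, t \in `[a, b] ->
    0 <= ((f a + f b) / 2 - sym f t) * ((g a + g b) / 2 - sym g t) /\
    (f (harmonic_mean a b) - sym f t) * ((g a + g b) / 2 - sym g t) <= 0.
Proof.
move=> Hcvx t tD.
case: Hcvx => [[cg cf]|[/harmonic_concaveN cg /harmonic_concaveN cf]].
  have hg := symmetrical_transform_le cg tD.
  have hF := symmetrized_convex_le cf tD; have hm := symmetrized_convex_ge cf tD.
  by rewrite mulr_ge0 ?mulr_le0_ge0 ?subr_ge0 ?subr_le0.
rewrite -symmetrical_transformN in cf.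
have := symmetrical_transform_le cg tD.
have := symmetrized_convex_le cf tD; have := symmetrized_convex_ge cf tD.
rewrite !symmetrical_transformN /= => hm hF hg.
by split; [apply: mulr_le0|apply: mulr_ge0_le0]; lra.
Qed.

End harmonic_reflection.

(** * Measures with a density *)

Lemma Rintegral_le0 d (T : measurableType d) (R : realType)
    (mu : {measure set T -> \bar R}) (D : set T) (f : T -> R) :
  (forall x, D x -> f x <= 0) -> \int[mu]_(x in D) f x <= 0.
Proof.
move=> f0; rewrite /Rintegral fine_le0// -oppe_ge0.
rewrite [X in (- X)%E](_ : _ = \int[mu]_(x in D) - (- f x)%:E)%E; last first.
  by apply: eq_integral => x _; rewrite -EFinN opprK.
rewrite integral_ge0N => [|x Dx]; last by rewrite lee_fin oppr_ge0 f0.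
by rewrite oppeK integral_ge0// => x Dx; rewrite lee_fin oppr_ge0 f0.
Qed.

Lemma density_measure_exists d (T : measurableType d) (R : realType)
    (mu : {measure set T -> \bar R}) (w : T -> \bar R) :
  (forall x, (0 <= w x)%E) -> mu.-integrable setT w ->
  exists nu : {finite_measure set T -> \bar R},
    forall A, measurable A -> nu A = (\int[mu]_(x in A) w x)%E.
Proof.
move=> w0 iw; have mw : measurable_fun setT w := measurable_int _ iw.
pose m (A : set T) := (\int[mu]_(x in A) w x)%E.
have m0 : m set0 = 0%E by rewrite /m integral_set0.
have mge0 A : (0 <= m A)%E by exact: integral_ge0.
have msig : semi_sigma_additive m by exact: semi_sigma_additive_nng_induced.
pose m1 := isMeasure.Build _ _ _ m m0 mge0 msig.
pose m2 : {measure set T -> \bar R} := HB.pack m m1.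
have mfin : fin_num_fun m2.
  move=> A mA; rewrite /= /m.
  by apply: integrable_fin_num => //; exact: integrableS iw.
pose m3 := Measure_isFinite.Build _ _ _ m2 mfin.
pose m4 : {finite_measure set T -> \bar R} := HB.pack (Measure.sort m2) m3.
by exists m4.
Qed.

Section density_integrals.
Context d (T : measurableType d) (R : realType).
Context (mu : {sigma_finite_measure set T -> \bar R}).
Context (nu : {finite_measure set T -> \bar R}) (w : T -> \bar R) (D : set T).
Hypotheses (mw : measurable_fun setT w) (w0 : forall x, (0 <= w x)%E).
Hypothesis nuE : forall A, measurable A -> nu A = (\int[mu]_(x in A) w x)%E.
Hypothesis mD : measurable D.

(** By uniqueness, w is almost everywhere the Radon-Nikodym derivative of nu. *)
Lemma ge0_integral_density (f : T -> \bar R) :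
  measurable_fun D f -> (forall x, 0 <= f x)%E ->
  (\int[nu]_(x in D) f x = \int[mu]_(x in D) (f x * w x))%E.
Proof.
move=> mf f0.
have numu : nu `<< mu.
  apply/null_content_dominatesP => A mA muA0.
  by rewrite nuE// null_set_integral//; exact: measurable_funTS.
have mfr := measurable_int _ (Radon_Nikodym_SigmaFinite.f_integrable numu).
rewrite -(Radon_Nikodym_SigmaFinite.change_of_variables numu)//.
apply: ge0_ae_eq_integral => //.
- by apply: emeasurable_funM => //; exact: measurable_funTS.
- by apply: emeasurable_funM => //; exact: measurable_funTS.
- move=> x _; rewrite mule_ge0//.
  exact: Radon_Nikodym_SigmaFinite.f_ge0.
- by move=> x _; rewrite mule_ge0.
apply: ae_eqe_mul2l; apply: integral_ae_eq => //.
- apply: (integrableS measurableT) => //.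
  exact: Radon_Nikodym_SigmaFinite.f_integrable.
- exact: measurable_funTS.
- move=> A _ mA.
  by rewrite -Radon_Nikodym_SigmaFinite.f_integral// nuE.
Qed.

(** Integrals are differences of integrals of positive and negative parts, and
multiplication by the nonnegative w commutes with taking either part. *)
Lemma Rintegral_density (v h : T -> R) :
  (forall t, D t -> w t = (v t)%:E) -> measurable_fun D h ->
  \int[mu]_(x in D) (h x * v x) = \int[nu]_(x in D) h x.
Proof.
move=> wE mh; rewrite /Rintegral; congr fine.
have mh' : measurable_fun D (EFin \o h) by exact/measurable_EFinP.
rewrite integralE [RHS]integralE !ge0_integral_density//; last 2 first.
- exact: measurable_funeneg.
- exact: measurable_funepos.
congr (_ - _)%E; apply: eq_integral => t; rewrite inE => tD;
  have := w0 t; rewrite (wE _ tD) lee_fin => vt0.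
- by rewrite !funeposE -!EFin_max -EFinM maxr_pMl ?mul0r.
- by rewrite !funenegE -!EFin_max -EFinM maxr_pMl ?mul0r ?mulNr.
Qed.

Lemma integrable_density (h : T -> R) (C : R) :
  (forall t, D t -> (w t <= C%:E)%E) ->
  mu.-integrable D (EFin \o h) -> nu.-integrable D (EFin \o h).
Proof.
move=> wC ih; have mh := measurable_int _ ih.
apply/integrableP; split => //.
rewrite ge0_integral_density//; last exact: measurableT_comp.
have ich : mu.-integrable D (fun x => C%:E * (h x)%:E)%E by exact: integrableZl.
have /integrableP[mch] := ich; apply: le_lt_trans.
apply: ge0_le_integral => //.
- by move=> t _; rewrite mule_ge0.
- apply: emeasurable_funM; first exact: measurableT_comp.
  exact: measurable_funTS.
- exact: measurableT_comp.
move=> t tD /=; rewrite normrM EFinM muleC lee_wpmul2r//.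
by rewrite (le_trans (wC _ tD))// lee_fin ler_norm.
Qed.

End density_integrals.

(** * Symmetrization under a measure preserving involution *)

(** On [a, b], with s = [reflection a b], this is the symmetrical transform. *)
Definition symmetrize {T : Type} {R : realType} (s : T -> T) (h : T -> R)
    (t : T) : R :=
  2^-1 * (h t + h (s t)).

Section symmetrization.
Context d (T : measurableType d) (R : realType).
Context (nu : {finite_measure set T -> \bar R}) (D : set T) (s : T -> T).
Hypotheses (mD : measurable D) (ms : measurable_fun setT s).
Hypotheses (sD : s @^-1` D = D) (sK : forall t, D t -> s (s t) = t).
Hypothesis nus : forall A, measurable A -> nu (s @^-1` A) = nu A.

Lemma integral_invariant (h : T -> \bar R) : measurable_fun D h ->
  (\int[nu]_(x in D) h (s x) = \int[nu]_(x in D) h x)%E.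
Proof.
move=> mh.
have ge0 k : measurable_fun D k -> (forall x, 0 <= k x)%E ->
    (\int[nu]_(x in D) k (s x) = \int[nu]_(x in D) k x)%E.
  move=> mk k0.
  have := ge0_integral_pushforward ms nu mD mk (fun x _ => k0 x).
  rewrite sD => <-; apply: eq_measure_integral => //.
  by move=> A mA _; exact: nus.
rewrite integralE [RHS]integralE; congr (_ - _)%E.
- rewrite -(ge0 _ (measurable_funepos mh))//.
  by apply: eq_integral => x _; rewrite !funeposE.
- rewrite -(ge0 _ (measurable_funeneg mh))//.
  by apply: eq_integral => x _; rewrite !funenegE.
Qed.

Lemma measurable_comp_invariant (h : T -> R) :
  measurable_fun D h -> measurable_fun D (h \o s).
Proof.
move=> mh; apply: (measurable_comp mD _ mh); last exact: measurable_funTS.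
by move=> _ [t tD <-]; rewrite -sD in tD.
Qed.

Lemma integrable_invariant (h : T -> R) :
  nu.-integrable D (EFin \o h) -> nu.-integrable D (EFin \o (h \o s)).
Proof.
move=> /integrableP[mh hoo]; apply/integrableP; split.
  by apply/measurable_EFinP/measurable_comp_invariant/measurable_EFinP.
rewrite -integral_invariant in hoo; first exact: hoo.
exact: measurableT_comp.
Qed.

Lemma Rintegral_symmetrize (h : T -> R) : nu.-integrable D (EFin \o h) ->
  \int[nu]_(x in D) symmetrize s h x = \int[nu]_(x in D) h x.
Proof.
move=> ih; have ihs := integrable_invariant ih.
have mh := measurable_int _ ih.
have Es : \int[nu]_(x in D) h (s x) = \int[nu]_(x in D) h x.
  by congr fine; exact: (integral_invariant (h := EFin \o h)).
rewrite /symmetrize RintegralZl//; last by have := integrableD mD ih ihs.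
by rewrite RintegralD// Es; lra.
Qed.

Lemma symmetrize_invariant (h : T -> R) t : D t ->
  symmetrize s h (s t) = symmetrize s h t.
Proof. by move=> tD; rewrite /symmetrize sK// addrC. Qed.

Lemma measurable_symmetrize (h : T -> R) :
  measurable_fun D h -> measurable_fun D (symmetrize s h).
Proof.
move=> mh; apply: measurable_funM => //; apply: measurable_funD => //.
exact: measurable_comp_invariant.
Qed.

Lemma bounded_integrable (h : T -> R) (M : R) :
  measurable_fun D h -> (forall t, D t -> `|h t| <= M) ->
  nu.-integrable D (EFin \o h).
Proof.
move=> mh hM.
apply: le_integrable (finite_measure_integrable_cst nu M mD) => //.
  exact/measurable_EFinP.
by move=> t tD; rewrite /= lee_fin (le_trans (hM _ tD))// ler_norm.
Qed.

(** Only the last term needs an argument: the symmetrization of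
(symmetrize s f) * g is the product of the two symmetrizations. *)
Lemma Rintegral_product_gap (H G Mf Mg : R) (f g : T -> R) :
  nu.-integrable D (EFin \o f) -> measurable_fun D g ->
  (forall t, D t -> `|symmetrize s f t| <= Mf) ->
  (forall t, D t -> `|g t| <= Mg) ->
  \int[nu]_(t in D) ((H - symmetrize s f t) * (G - symmetrize s g t)) =
  H * G * fine (nu D) - H * (\int[nu]_(t in D) g t)
  - G * (\int[nu]_(t in D) f t) + \int[nu]_(t in D) (symmetrize s f t * g t).
Proof.
move=> if0 mg bf bg.
have mf : measurable_fun D f.
  by apply/measurable_EFinP; exact: measurable_int if0.
have msf := measurable_symmetrize mf; have msg := measurable_symmetrize mg.
have bsg t : D t -> `|symmetrize s g t| <= Mg.
  move=> tD; have := bg _ tD; have : D (s t) by rewrite -sD in tD.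
  move=> /bg; rewrite /symmetrize !ler_norml.
  by move=> /andP[h1 h2] /andP[h3 h4]; apply/andP; split; lra.
have ign := bounded_integrable mg bg.
have isf := bounded_integrable msf bf.
have isg := bounded_integrable msg bsg.
have iprod (h : T -> R) : measurable_fun D h ->
    (forall t, D t -> `|h t| <= Mg) ->
    nu.-integrable D (EFin \o (fun t => symmetrize s f t * h t)).
  move=> mh hM; apply: (bounded_integrable (M := Mf * Mg)).
    exact: measurable_funM.
  by move=> t tD; rewrite normrM ler_pM// ?bf ?hM.
have isfg := iprod _ mg bg; have isfsg := iprod _ msg bsg.
have ic k : nu.-integrable D (EFin \o (fun _ => k)).
  exact: finite_measure_integrable_cst.
have iH : nu.-integrable D (EFin \o (fun t => H * symmetrize s g t)).
  by have := integrableZl mD H isg.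
have iG : nu.-integrable D (EFin \o (fun t => G * symmetrize s f t)).
  by have := integrableZl mD G isf.
have i1 : nu.-integrable D (EFin \o (fun t => H * G - H * symmetrize s g t)).
  by have := integrableB mD (ic (H * G)) iH.
have i2 : nu.-integrable D
    (EFin \o (fun t => H * G - H * symmetrize s g t - G * symmetrize s f t)).
  by have := integrableB mD i1 iG.
transitivity (\int[nu]_(t in D) (H * G - H * symmetrize s g t
    - G * symmetrize s f t + symmetrize s f t * symmetrize s g t)).
  by apply: eq_Rintegral => t _; ring.
rewrite RintegralD// RintegralB// RintegralB// Rintegral_cst//.
rewrite (RintegralZl H mD isg) (RintegralZl G mD isf).
rewrite !Rintegral_symmetrize//; congr (_ + _).
rewrite -[RHS]Rintegral_symmetrize//; apply: eq_Rintegral => t.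
rewrite inE => tD.
rewrite [RHS]/symmetrize symmetrize_invariant// /(symmetrize s g).
by ring.
Qed.

End symmetrization.

(** * Borel and Lebesgue measurability *)

(** The real line with its Lebesgue measurable sets, which are the sets
measurable in the sense of Caratheodory for the outer measure generated by the
length. *)
Local Notation lebesgue_type R := (caratheodory_type (@wlength R idfun)^*%mu).

Lemma borel_lebesgue_measurable (R : realType) (A : set (measurableTypeR R)) :
  measurable A -> @measurable _ (lebesgue_type R) A.
Proof. exact: sub_caratheodory. Qed.

Lemma measurable_id_lebesgue (R : realType) :
  measurable_fun setT (idfun : lebesgue_type R -> measurableTypeR R).
Proof.
by move=> _ A mA; rewrite setTI preimage_id; exact: borel_lebesgue_measurable.
Qed.

Lemma borel_lebesgue_measurable_fun (R : realType) d (T : measurableType d)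
    (D : set (measurableTypeR R)) (f : R -> T) :
  measurable D -> measurable_fun D (f : measurableTypeR R -> T) ->
  @measurable_fun _ _ (lebesgue_type R) T D f.
Proof.
by move=> mD mf _ A mA; apply: borel_lebesgue_measurable; exact: mf.
Qed.

(** The Lebesgue measure on Borel sets is the image under the identity of its
completion. *)
Lemma ge0_integral_lebm (R : realType) (D : set (measurableTypeR R))
    (f : measurableTypeR R -> \bar R) :
  measurable D -> measurable_fun D f -> (forall x, 0 <= f x)%E ->
  (\int[lebm]_(x in D) f x = \int[lebesgue_measure]_(x in D) f x)%E.
Proof.
move=> mD mf f0.
by rewrite -(ge0_integral_pushforward (measurable_id_lebesgue (R := R)) lebm).
Qed.

Lemma lebesgue_measurable_sandwich (R : realType) (A : set (lebesgue_type R)) :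
  measurable A ->
  exists X B : set (measurableTypeR R), [/\ measurable X, measurable B,
    lebesgue_measure B = 0%E, X `<=` A & A `<=` X `|` B].
Proof.
rewrite -completed_caratheodory_measurable g_sigma_completed_algebra_genE.
move=> [X mX [N [B [mB B0 NB]]] <-]; exists X, B; split => //.
exact: setUS.
Qed.

(** * The measure dt/t^2 and its invariance *)

(** The density of the measure dt/t^2 on [a, b] viewed as a measure on the whole
line. *)
Definition inv_sq_weight {R : realType} (a b t : R) : \bar R :=
  if t \in `[a, b] then ((t ^+ 2)^-1)%:E else 0%E.

Section inv_sq_measure.
Context {R : realType} (a b : R).
Hypotheses (ltab : a < b) (ab0 : 0 \notin (`[a, b]%R : interval R)).
Local Notation borelR := (measurableTypeR R).
Local Notation lebR := (lebesgue_type R).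
Local Notation D := (`[a, b]%classic : set R).
Local Notation w := (inv_sq_weight a b).
Local Notation sigma := (reflection a b).

Lemma inv_sq_quasiconvex x y z : x \in `[a, b] -> y \in `[a, b] ->
  x <= z <= y -> (z ^+ 2)^-1 <= Num.max (x ^+ 2)^-1 (y ^+ 2)^-1.
Proof.
move: ab0; rewrite !in_itv/= negb_and -!ltNge le_max.
move=> /orP[] h /andP[h3 h4] /andP[h5 h6] /andP[h7 h8]; apply/orP;
  [left|right].
- by rewrite lef_pV2 ?posrE ?exprn_gt0//; nra.
- rewrite lef_pV2 ?posrE ?exprn_even_gt0//=; first by nra.
  by rewrite lt_eqF//; lra.
  by rewrite lt_eqF//; lra.
Qed.

Lemma inv_sq_weightE t : t \in `[a, b] -> w t = ((t ^+ 2)^-1)%:E.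
Proof. by rewrite /inv_sq_weight => ->. Qed.

Lemma inv_sq_weight_ge0 t : (0 <= w t)%E.
Proof.
by rewrite /inv_sq_weight; case: (t \in _) => //; rewrite lee_fin invr_ge0 sqr_ge0.
Qed.

Lemma inv_sq_weight_patch : w = w \_ D.
Proof.
apply/funext => t; rewrite patchE /inv_sq_weight.
have -> : (t \in D) = (t \in `[a, b]) by apply/idP/idP; rewrite inE.
by case: ifP.
Qed.

Lemma measurable_inv_sq_weight : measurable_fun [set: borelR] w.
Proof.
have mD : measurable (D : set borelR) by exact: measurable_itv.
have mV : measurable_fun (D : set borelR) (fun t : R => (t ^+ 2)^-1).
  apply: quasiconvex_measurable; first exact: interval_is_interval.
  by move=> x y z; exact: inv_sq_quasiconvex.
have /measurable_EFinP/(measurable_restrictT _ mD) := mV.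
congr measurable_fun; apply/funext => t; rewrite patchE /inv_sq_weight.
by congr (if _ then _ else _); apply/idP/idP; rewrite inE.
Qed.

Lemma integral_inv_sq x y : x \in `[a, b] -> y \in `[a, b] -> x <= y ->
  (\int[lebm]_(t in `[x, y]) w t = (x^-1 - y^-1)%:E)%E.
Proof.
move=> hx hy xy.
have mw A : measurable_fun (A : set borelR) w.
  by apply: measurable_funTS; exact: measurable_inv_sq_weight.
have mxy : measurable (`[x, y] : set borelR) by exact: measurable_itv.
rewrite ge0_integral_lebm//; last exact: inv_sq_weight_ge0.
move: xy; rewrite le_eqVlt => /predU1P[<-|xy].
  by rewrite set_itv1 subrr integral_set1.
have sub t : t \in `[x, y] -> t \in `[a, b].
  by rewrite in_itv/= => /(sub_itv hx hy).
have sub0 t : t \in `[x, y] -> t != 0 by move=> /sub; exact: itv_neq0.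
have dF (t : R) : t != 0 ->
    is_derive t (1:R) (fun s : R => - s^-1) ((t ^+ 2)^-1).
  move=> t0; have := is_deriveN (is_deriveV t0 (is_derive_id t (1:R))).
  by rewrite /= scaleNr opprK [_ *: _]mulr1.
have cF t : t != 0 -> {for t, continuous (fun s : R => - s^-1)}.
  by move=> t0; apply: continuousN; exact: inv_continuous.
rewrite (eq_integral (fun t : borelR => (((t : R) ^+ 2)^-1)%:E)); last first.
  by move=> t; rewrite inE => /sub /inv_sq_weightE.
rewrite (@continuous_FTC2 _ _ (fun s : R => - s^-1))//.
- by rewrite -EFinB opprK addrC.
- apply: continuous_in_subspaceT => t; rewrite inE => /sub0 t0.
  apply: cvgV; last exact: exprn_continuous.
  by rewrite expf_neq0.
- split.
  + move=> t /subset_itv_oo_cc /sub0 t0.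
    by have [] := dF _ t0.
  + by apply: cvg_at_right_filter; exact/cF/(itv_neq0 ab0).
  + by apply: cvg_at_left_filter; exact/cF/(itv_neq0 ab0).
- move=> t /subset_itv_oo_cc /sub0 t0.
  by rewrite derive1E; have [_ ->] := dF _ t0.
Qed.

Lemma integrable_inv_sq_weight : lebm.-integrable (setT : set lebR) w.
Proof.
have mT : measurable_fun (setT : set lebR) w.
  apply: borel_lebesgue_measurable_fun => //.
  exact: measurable_inv_sq_weight.
apply/integrableP; split => //.
under eq_integral do rewrite gee0_abs ?inv_sq_weight_ge0//.
rewrite inv_sq_weight_patch -integral_mkcond.
by rewrite integral_inv_sq ?a_in ?b_in ?ltry//; exact: ltW.
Qed.

Lemma measurable_reflection_borel :
  measurable_fun setT (sigma : borelR -> borelR).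
Proof.
rewrite /reflection; apply: measurable_fun_if => //.
- apply: (measurable_fun_bool true); rewrite setTI.
  rewrite (_ : _ @^-1` _ = D); first exact: measurable_itv.
  by apply/seteqP; split=> t.
- rewrite setTI (_ : _ @^-1` _ = D); last by apply/seteqP; split=> t.
  apply: quasiconvex_measurable; first exact: interval_is_interval.
  move=> x y z hx hy xzy; have hz := sub_itv hx hy xzy.
  by rewrite le_max harmonic_reflection_le//; case/andP: xzy => ->.
Qed.

Lemma measurable_reflection_lebesgue_borel :
  measurable_fun setT (sigma : lebR -> borelR).
Proof.
apply: borel_lebesgue_measurable_fun => //.
exact: measurable_reflection_borel.
Qed.

Lemma measurable_preimage_borel (A : set borelR) :
  measurable A -> @measurable _ lebR (sigma @^-1` A).
Proof.
move=> mA; rewrite -[X in measurable X]setTI.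
exact: measurable_reflection_lebesgue_borel.
Qed.

Lemma preimage_reflection_setI (A : set R) :
  sigma @^-1` A `&` D =
  [set t | t \in `[a, b] /\ A (harmonic_reflection a b t)].
Proof.
rewrite /reflection; apply/seteqP; split => [t [/= + tD]|t [/= tD At]].
  by rewrite tD.
by split => //=; rewrite tD.
Qed.

Section invariance.
Context (nu : {finite_measure set lebR -> \bar R}).
Hypothesis nuE : forall A, measurable A -> nu A = (\int[lebm]_(x in A) w x)%E.

Let mD : measurable (D : set lebR).
Proof. by apply: borel_lebesgue_measurable; exact: measurable_itv. Qed.

Let mw (A : set lebR) : measurable_fun A w.
Proof.
by apply: measurable_funTS; exact: measurable_int integrable_inv_sq_weight.
Qed.

Lemma inv_sq_measure_restrict A : measurable A -> nu A = nu (A `&` D).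
Proof.
move=> mA; rewrite !nuE//; last exact: measurableI.
by rewrite integral_mkcondr -inv_sq_weight_patch.
Qed.

Lemma inv_sq_measure_itv x y : x \in `[a, b] -> y \in `[a, b] -> x <= y ->
  nu `[x, y]%classic = (x^-1 - y^-1)%:E.
Proof.
move=> *; rewrite nuE ?integral_inv_sq//.
by apply: borel_lebesgue_measurable; exact: measurable_itv.
Qed.

(** For c in [a, b], the part of the ray in [a, b] is [c, b], and that of its
preimage is [a, sigma(c)], of measure 1/a - 1/sigma(c) = 1/c - 1/b. *)
Lemma inv_sq_measure_reflection_ray c :
  nu (sigma @^-1` `[c, +oo[) = nu `[c, +oo[%classic.
Proof.
have mr : measurable (`[c, +oo[ : set borelR) by exact: measurable_itv.
rewrite inv_sq_measure_restrict; last exact: measurable_preimage_borel.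
rewrite [RHS]inv_sq_measure_restrict; last exact: borel_lebesgue_measurable.
rewrite preimage_reflection_setI.
have rin := harmonic_reflection_in ltab ab0.
have rK := harmonic_reflectionK ltab ab0.
have [cb|bc] := leP c b; last first.
  congr (nu _); apply/seteqP; split => t /=.
    move=> [/rin]; rewrite !in_itv/= andbT => /andP[_ h1] /(lt_le_trans bc).
    by rewrite ltNge h1.
  rewrite !in_itv/= => -[/andP[/(lt_le_trans bc)]].
  by rewrite ltNge => + _ /andP[_ h]; rewrite h.
have [ca|ac] := leP c a.
  congr (nu _); apply/seteqP; split => t /=.
    move=> [ht]; have := ht; rewrite !in_itv/= !andbT => /andP[h _]; split => //.
    exact: le_trans ca h.
  move=> [_ ht]; split => //; have := rin _ ht.
  by rewrite !in_itv/= andbT => /andP[h _]; exact: le_trans ca h.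
have hc : c \in `[a, b] by rewrite in_itv/= cb ltW.
have hc' := rin _ hc.
transitivity (nu `[a, harmonic_reflection a b c]%classic).
  congr (nu _); apply/seteqP; split => t /=.
    move=> [ht]; have := ht; rewrite !in_itv/= !andbT => /andP[-> _].
    by rewrite -{1}(rK _ hc) harmonic_reflection_le.
  move=> ht; have htD : t \in `[a, b].
    move: ht hc'; rewrite !in_itv/= => /andP[-> h] /andP[_]; exact: le_trans.
  split => //; rewrite in_itv/= andbT -{1}(rK _ hc).
  by rewrite harmonic_reflection_le//; move: ht; rewrite in_itv => /andP[].
transitivity (nu `[c, b]%classic); last first.
  congr (nu _); apply/seteqP; split => t /=; rewrite !in_itv/= ?andbT.
    by move=> /andP[h ->]; rewrite h (le_trans (ltW ac) h).
  by move=> [-> /andP[_ ->]].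
rewrite !inv_sq_measure_itv// ?a_in ?b_in// ?harmonic_reflectionV//.
  by congr (_%:E); ring.
by move: hc'; rewrite in_itv => /andP[].
Qed.

(** The rays [c, +oo[ form a pi-system that generates the Borel sets. *)
Lemma inv_sq_measure_reflection_borel (A : set borelR) :
  measurable A -> nu (sigma @^-1` A) = nu A.
Proof.
move=> mA.
pose f1 := isMeasurableFun.Build _ _ _ _ _ measurable_reflection_lebesgue_borel.
pose s1 : {mfun lebR >-> borelR} := HB.pack (sigma : lebR -> borelR) f1.
pose f2 := isMeasurableFun.Build _ _ _ _ _ (measurable_id_lebesgue (R := R)).
pose s2 : {mfun lebR >-> borelR} := HB.pack (idfun : lebR -> borelR) f2.
apply: (@measure_unique _ _ borelR (@RGenCInfty.G R)
  (fun k => `[- k%:R, +oo[%classic) _ _ _ _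
  (pushforward nu s1) (pushforward nu s2)) => //.
- exact: RGenCInfty.measurableE.
- move=> _ _ [x ->] [y ->]; exists (Num.max x y).
  apply/seteqP; split => t /=; rewrite !in_itv/= !andbT ge_max.
    by move=> [-> ->].
  by move=> /andP[].
- by move=> k; exists (- k%:R).
- apply/seteqP; split => // t _.
  exists (Num.bound `|t|) => //=; rewrite in_itv/= andbT lerNl.
  by rewrite (le_trans (ler_norm _))// normrN ltW// archi_boundP.
- by move=> _ [c ->]; exact: inv_sq_measure_reflection_ray.
- move=> k; rewrite ltey_eq fin_num_measure//.
  by apply: measurable_preimage_borel; exact: measurable_itv.
Qed.

Lemma inv_sq_measure_borel_null (B : set borelR) :
  measurable B -> lebesgue_measure B = 0%E -> nu B = 0%E.
Proof.
move=> mB B0; have mB' := borel_lebesgue_measurable mB.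
by rewrite nuE// null_set_integral.
Qed.

(** The density does not vanish on [a, b], so conversely nu-null subsets of [a, b]
are Lebesgue null. *)
Lemma inv_sq_measure_null (A : set lebR) :
  measurable A -> A `<=` D -> nu A = 0%E -> lebm A = 0%E.
Proof.
move=> mA AD; rewrite nuE// => int0.
have : (\int[lebm]_(x in A) `|w x| = 0)%E.
  by under eq_integral do rewrite gee0_abs ?inv_sq_weight_ge0//.
move=> /(ae_eq_integral_abs lebm mA (mw (A := A)))[N [mN N0 sN]].
apply: (subset_measure0 mA mN) => //; apply: subset_trans sN.
move=> t At /= /(_ At); have tD : t \in `[a, b] := AD _ At.
rewrite inv_sq_weightE//= => -[] /eqP; rewrite invr_eq0 sqrf_eq0.
by rewrite (negbTE (itv_neq0 ab0 tD)).
Qed.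

(** Squeeze A between Borel sets X and X `|` B with B null. The preimage of B is
null: inside [a, b] because nu is invariant on Borel sets, and outside of [a, b]
because sigma is the identity there. *)
Lemma measurable_reflection : measurable_fun setT (sigma : lebR -> lebR).
Proof.
move=> _ A /lebesgue_measurable_sandwich[X [B [mX mB B0 XA AXB]]]; rewrite setTI.
have mpX := measurable_preimage_borel mX.
have mpB := measurable_preimage_borel mB.
have mpBD : @measurable _ lebR (sigma @^-1` B `&` D) by exact: measurableI.
have mB' := borel_lebesgue_measurable mB.
have nB : nu (sigma @^-1` B) = 0%E.
  rewrite inv_sq_measure_reflection_borel//.
  exact: inv_sq_measure_borel_null.
have null : lebm (sigma @^-1` B `&` D) = 0%E.
  apply: inv_sq_measure_null => //.
  by rewrite -inv_sq_measure_restrict; [exact: nB|exact: mpB].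
have mC : @measurable _ lebR (sigma @^-1` A `\` sigma @^-1` X).
  apply: negligible_sub_caratheodory.
  exists (sigma @^-1` B `&` D `|` B); split.
  - exact: measurableU.
  - by rewrite measureU0.
  - move=> t [At Xt]; have [//|Bt] := AXB _ At.
    have [tD|tD] := boolP (t \in `[a, b]); first by left.
    by right; move: Bt; rewrite /reflection (negbTE tD).
rewrite -(setDUK (preimage_subset XA)).
exact: measurableU.
Qed.

(** For Borel sets X and B with B null and X `<=` A `<=` X `|` B, the sets X, A and
X `|` B have the same measure, and so have their preimages. *)
Lemma inv_sq_measure_reflection (A : set lebR) :
  measurable A -> nu (sigma @^-1` A) = nu A.
Proof.
move=> mA; have [X [B [mX mB B0 XA AXB]]] := lebesgue_measurable_sandwich mA.
have mXB : measurable (X `|` B) by exact: measurableU.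
have mX' := borel_lebesgue_measurable mX.
have mXB' := borel_lebesgue_measurable mXB.
have nB : nu (X `|` B) = nu X.
  rewrite measureU0//; [exact: borel_lebesgue_measurable|].
  exact: inv_sq_measure_borel_null.
have mpA : @measurable _ lebR (sigma @^-1` A).
  by rewrite -[X in measurable X]setTI; exact: measurable_reflection.
have mpX := measurable_preimage_borel mX.
have mpXB := measurable_preimage_borel mXB.
transitivity (nu X); apply/eqP; rewrite eq_le; apply/andP; split.
- rewrite -nB -(inv_sq_measure_reflection_borel mXB).
  by apply: le_measure; rewrite ?inE//; exact: preimage_subset.
- rewrite -(inv_sq_measure_reflection_borel mX).
  by apply: le_measure; rewrite ?inE//; exact: preimage_subset.
- by apply: le_measure; rewrite ?inE.
- by rewrite -nB; apply: le_measure; rewrite ?inE.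
Qed.

End invariance.

(** * The integrated inequality *)

Local Notation sym := (symmetrical_transform a b).

Lemma symmetrize_reflection (h : R -> R) t : t \in `[a, b] ->
  symmetrize sigma h t = sym h t.
Proof. by move=> tD; rewrite /symmetrize /reflection tD. Qed.

(** The witness is the measure dt/t^2. Once the left-hand side is evaluated, only
its sign is used, and that is the same for every measure. *)
Lemma symmetrical_transform_gap (Mf Mg G : R) (f g : R -> R) :
  lebm.-integrable (D : set lebR) (EFin \o f) ->
  measurable_fun (D : set borelR) g ->
  (forall t, t \in `[a, b] -> `|sym f t| <= Mf) ->
  (forall t, t \in `[a, b] -> `|g t| <= Mg) ->
  exists nu : {measure set lebR -> \bar R}, forall H,
    \int[nu]_(t in D) ((H - sym f t) * (G - sym g t)) =
    H * G * (a^-1 - b^-1) - H * (\int[lebm]_(t in D) (g t / t ^+ 2))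
    - G * (\int[lebm]_(t in D) (f t / t ^+ 2))
    + \int[lebm]_(t in D) (sym f t * g t / t ^+ 2).
Proof.
move=> fint mgb bf bg.
have w0 : forall t : lebR, (0 <= w t)%E := inv_sq_weight_ge0.
have iw := integrable_inv_sq_weight.
have [nu nuE] := density_measure_exists w0 iw.
have mDb : measurable (D : set borelR) by exact: measurable_itv.
have mD : measurable (D : set lebR) by exact: borel_lebesgue_measurable.
have mw : measurable_fun (setT : set lebR) w by exact: measurable_int iw.
have intE (h : R -> R) : measurable_fun (D : set lebR) h ->
    \int[lebm]_(t in D) (h t / t ^+ 2) = \int[nu]_(t in D) h t.
  by apply: (Rintegral_density mw w0 nuE mD (v := fun t : R => (t ^+ 2)^-1)) => t;
    exact: inv_sq_weightE.
have fnu : nu.-integrable (D : set lebR) (EFin \o f).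
  apply: (integrable_density mw w0 nuE mD
    (C := Num.max (a ^+ 2)^-1 (b ^+ 2)^-1)) => //.
  move=> t tD; rewrite inv_sq_weightE// lee_fin.
  by apply: inv_sq_quasiconvex; rewrite ?a_in ?b_in//; rewrite /= in_itv in tD.
have mf : measurable_fun (D : set lebR) f.
  by apply/measurable_EFinP; exact: measurable_int fint.
have mg : measurable_fun (D : set lebR) g.
  exact: borel_lebesgue_measurable_fun.
have ms := measurable_reflection nuE.
have sD := preimage_reflection ltab ab0.
have mfs : measurable_fun (D : set lebR) (sym f).
  have := @measurable_symmetrize _ lebR R D _ mD ms sD f mf.
  by apply: eq_measurable_fun => t; rewrite inE => /symmetrize_reflection.
exists nu => H.
rewrite (intE g)// (intE f)// (intE (fun t => sym f t * g t)); last first.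
  exact: measurable_funM.
have := @Rintegral_product_gap _ lebR R nu D _ mD ms sD (reflectionK ltab ab0)
  (inv_sq_measure_reflection nuE) H G Mf Mg f g fnu mg.
rewrite (inv_sq_measure_itv nuE (a_in ltab) (b_in ltab) (ltW ltab)) /=.
have -> : \int[nu]_(t in D) (symmetrize sigma f t * g t)
    = \int[nu]_(t in D) (sym f t * g t).
  by apply: eq_Rintegral => t; rewrite inE => tD; rewrite symmetrize_reflection.
move=> <- //; last by move=> t tD; rewrite symmetrize_reflection// bf.
apply: eq_Rintegral => t; rewrite inE => tD.
by rewrite !symmetrize_reflection.
Qed.

End inv_sq_measure.

(** K is the mass of dt/t^2 on [a, b] and c = ab/(b-a) normalizes it; A, B and C
stand for the integrals of g, of f and of fs * g. *)
Lemma scale_gaps (R : realFieldType) (c K F G m A B C : R) :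
  c * K = 1 -> 0 <= c ->
  0 <= F * G * K - F * A - G * B + C -> m * G * K - m * A - G * B + C <= 0 ->
  F * (c * A) + G * (c * B) - F * G <= c * C /\
  c * C <= G * (c * B) + m * (c * A) - m * G.
Proof.
move=> cK c0 /(mulr_ge0 c0) h1 /(mulr_ge0_le0 c0) h2.
have E x : c * (x * G * K - x * A - G * B + C) =
    x * G - x * (c * A) - G * (c * B) + c * C.
  by rewrite -[x * G in RHS]mulr1 -cK; ring.
by move: h1 h2; rewrite !E => h1 h2; split; lra.
Qed.

Unset Implicit Arguments.
Set Strict Implicit.

Theorem theorem4 (R : realType) (a b : R) (f g : R -> R)
  (ltab : a < b)
  (ab0 : 0 \notin (`[a, b]%R : interval R))
  (f_int : lebm.-integrable `[a, b] (EFin \o f))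
  (Hcvx : (harmonic_convex `[a, b] g /\ symmetrized_harmonic_convex a b f) \/
          (harmonic_concave `[a, b] g /\ symmetrized_harmonic_concave a b f)) :
  let fs := symmetrical_transform a b f in
  (f a + f b) / 2 * (a * b / (b - a) * \int[lebm]_(t in `[a, b]) (g t / t ^+ 2))
    + (g a + g b) / 2 * (a * b / (b - a) * \int[lebm]_(t in `[a, b]) (f t / t ^+ 2))
    - (f a + f b) / 2 * ((g a + g b) / 2)
  <= a * b / (b - a) * \int[lebm]_(t in `[a, b]) (fs t * g t / t ^+ 2)
  /\
  a * b / (b - a) * \int[lebm]_(t in `[a, b]) (fs t * g t / t ^+ 2)
  <= (g a + g b) / 2 * (a * b / (b - a) * \int[lebm]_(t in `[a, b]) (f t / t ^+ 2))
    + f (2 * a * b / (a + b))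
      * (a * b / (b - a) * \int[lebm]_(t in `[a, b]) (g t / t ^+ 2))
    - f (2 * a * b / (a + b)) * ((g a + g b) / 2).
Proof.
move=> fs.
have [mg [Mg bg]] : measurable_fun (`[a, b] : set (measurableTypeR R)) g /\
    exists M, forall t, t \in `[a, b] -> `|g t| <= M.
  by apply: harmonic_regular => //; case: Hcvx => -[]; [left|right].
have [_ [Mf bf]] : measurable_fun (`[a, b] : set (measurableTypeR R)) fs /\
    exists M, forall t, t \in `[a, b] -> `|fs t| <= M.
  by apply: harmonic_regular => //; case: Hcvx => -[]; [left|right].
have signs := product_gap_signs ltab ab0 Hcvx.
have [nu gapE] :=
  symmetrical_transform_gap ltab ab0 ((g a + g b) / 2) f_int mg bf bg.
have a0 := itv_neq0 ab0 (a_in ltab); have b0 := itv_neq0 ab0 (b_in ltab).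
have ba0 : 0 < b - a by rewrite subr_gt0.
(* [harmonic_mean a b] unfolds to the argument of f in the second inequality. *)
apply: (@scale_gaps _ _ (a^-1 - b^-1)).
- by field; rewrite ?a0 ?b0 ?(lt0r_neq0 ba0).
- by rewrite divr_ge0 ?(ltW ba0)// ltW// (itv_mul_gt0 ab0) ?a_in ?b_in.
- by rewrite -gapE; apply: Rintegral_ge0 => t /signs[].
- by rewrite -gapE; apply: Rintegral_le0 => t /signs[].
Qed.
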